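(* Let $K$ be a field. If $I\subset S=K[t_1,\ldots,t_s]$ is a Simis monomial ideal and $k\geq 1$ is an integer, then $I^k$ is a Simis ideal.
   Context: For an ideal $I\subset S$ and $n\geq 1$, the $n$-th symbolic power is $I^{(n)}:=\bigcap_{\mathfrak{p}\in\mathrm{minAss}(I)}(I^nS_{\mathfrak{p}}\cap S)$, where $\mathrm{minAss}(I)$ is the set of inclusion-minimal associated primes of $I$. A monomial ideal $I$ is a Simis ideal if $I^{(n)}=I^n$ for all $n\geq 1$. *)

(* Defs.v *)
From HB Require Import structures.
From mathcomp Require Import all_boot all_order all_algebra.
From mathcomp Require Import classical_sets.
From mathcomp Require Import mpoly.

Set Implicit Arguments.
Unset Strict Implicit.
Unset Printing Implicit Defensive.

Import GRing.Theory.
Local Open Scope ring_scope.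
Local Open Scope classical_set_scope.

(* Ideals are [set R] rather than the [idealr R] of ring_quotient, which are
   boolean predicates and exclude the unit ideal. *)

Section Ideals.
Variable R : comNzRingType.
Implicit Types (I J p : set R).

Definition is_ideal I : Prop :=
  [/\ I 0, (forall x y, I x -> I y -> I (x + y))
    & (forall a x, I x -> I (a * x))].

(* When C is a subring of R, this is the C-submodule of R generated by A. *)
Definition lin_span (C A : set R) : set R :=
  [set x | exists (m : nat) (c a : 'I_m -> R),
     [/\ forall i, C (c i), forall i, A (a i) & x = \sum_(i < m) c i * a i]].

Definition ideal_gen (A : set R) : set R := lin_span setT A.

Definition ideal_mul I J : set R :=
  ideal_gen [set x | exists a b, [/\ I a, J b & x = a * b]].

Definition ideal_pow I (n : nat) : set R := iter n (ideal_mul I) setT.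

Definition is_prime_ideal p : Prop :=
  [/\ is_ideal p, ~ p 1 & (forall x y, p (x * y) -> p x \/ p y)].

Definition colon I (f : R) : set R := [set g | I (g * f)].

Definition Ass I : set (set R) :=
  [set p | is_prime_ideal p /\ exists f, p = colon I f].

Definition minAss I : set (set R) :=
  [set p | Ass I p /\ forall q, Ass I q -> q `<=` p -> q = p].

End Ideals.

Section Localization.
Variable R : idomainType.
Implicit Types (I p : set R).

(* Since R is a domain, R_p, for p a prime ideal, is taken inside the fraction
   field of R. *)
Definition localization p : set {fraction R} :=
  [set x | exists a b, ~ p b /\ x = tofrac a / tofrac b].

Definition ideal_ext p I : set {fraction R} :=
  lin_span (localization p) [set tofrac a | a in I].

(* J R_p `&` R *)
Definition local_contraction p J : set R := [set f | ideal_ext p J (tofrac f)].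

(* If I is the unit ideal then Ass I is empty and the empty intersection is R. *)
Definition symbolic_power I (n : nat) : set R :=
  \bigcap_(p in minAss I) local_contraction p (ideal_pow I n).

End Localization.

Section Monomial.
Variables (K : fieldType) (s : nat).
Implicit Types (I : set {mpoly K[s]}).

Definition is_monomial_ideal I : Prop :=
  exists A : set 'X_{1..s}, I = ideal_gen [set 'X_[m] | m in A].

Definition is_simis_ideal I : Prop :=
  is_monomial_ideal I /\
  forall n : nat, (1 <= n)%N -> symbolic_power I n = ideal_pow I n.

End Monomial.

(* Main.v *)
Require Import Defs.
From mathcomp Require Import all_boot all_order all_algebra.
From mathcomp Require Import boolp classical_sets.
From mathcomp Require Import mpoly zify.

Set Implicit Arguments.
Unset Strict Implicit.
Unset Printing Implicit Defensive.

(** Since (I^k)^n = I^(kn), the only thing that can go wrong is that the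
  intersection defining the symbolic powers of I^k runs over other primes than
  the one for I.  It does not: I and I^k have the same minimal associated
  primes.  Half of that is enough here.  If every p in minAss(I) is in
  minAss(I^k), then (I^k)^(n) is an intersection of contractions of I^(kn) over
  at least the primes used for I^(kn), so it is contained in the symbolic power
  I^((kn)), which is I^(kn) because I is Simis ([symbolic_pow_sub]).  The
  reverse inclusion holds for every ideal ([pow_sub_symbolic]).

  The comparison of minimal primes ([minAss_pow_sub]) rests on the fact that a
  prime containing J contains an associated prime of J, used for J = I and for
  J = I^k; a prime contains one of these ideals exactly when it contains the
  other.

  For a general Noetherian ring that fact needs primary decomposition or a
  maximal annihilator.  For a monomial ideal J it is combinatorial
  ([monomial_Ass_below]).  Let q be a prime containing J.  A monomial in q is
  divisible by a variable in q, so J lies in the face ideal generated by the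
  variables of q.  Shrink this set of variables to a minimal set A whose face
  ideal P_A still contains J.  Then P_A is an associated prime
  ([face_ideal_Ass]): by minimality of A, once the variables outside A are
  inverted, J contains a power of each variable of A, so it has a socle
  monomial, and its annihilator modulo J is P_A. *)

(** * Ideals, their powers and the primes containing them *)

Section IdealTheory.

Import GRing.Theory.
Local Open Scope ring_scope.
Local Open Scope classical_set_scope.

Variable R : comNzRingType.
Implicit Types (I J L p : set R).

Lemma ideal_sum I (T : Type) (r : seq T) (P : pred T) (F : T -> R) :
  is_ideal I -> (forall i, P i -> I (F i)) -> I (\sum_(i <- r | P i) F i).
Proof. by case=> I0 ID _ IF; apply: big_ind. Qed.

Lemma sub_ideal_gen (A : set R) : A `<=` ideal_gen A.
Proof.
move=> x Ax; exists 1, (fun=> 1), (fun=> x); split=> //.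
by rewrite big_ord1 mul1r.
Qed.

Lemma ideal_gen_sub (A J : set R) :
  is_ideal J -> A `<=` J -> ideal_gen A `<=` J.
Proof.
move=> idJ AJ _ [m [c [a [_ Aa ->]]]]; have [_ _ JM] := idJ.
by apply: ideal_sum => // i _; apply/JM/AJ/Aa.
Qed.

Lemma is_ideal_gen (A : set R) : is_ideal (ideal_gen A).
Proof.
split.
- exists 0, (fun=> 0), (fun=> 0); split=> //; [by case | by rewrite big_ord0].
- move=> _ _ [m [c [a [_ Aa ->]]]] [n [d [b [_ Ab ->]]]].
  pose glue (f : 'I_m -> R) (g : 'I_n -> R) i :=
    match split i with inl j => f j | inr j => g j end.
  exists (m + n)%N, (glue c d), (glue a b); split=> //.
    by move=> i; rewrite /glue; case: split.
  rewrite big_split_ord /glue; congr (_ + _); apply: eq_bigr => i _.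
    by rewrite -[lshift n i]/(unsplit (inl i)) unsplitK.
  by rewrite -[rshift m i]/(unsplit (inr i)) unsplitK.
- move=> x _ [m [c [a [_ Aa ->]]]].
  exists m, (fun i => x * c i), a; split=> //.
  by rewrite mulr_sumr; apply: eq_bigr => i _; rewrite mulrA.
Qed.

Lemma is_idealT : is_ideal (@setT R).
Proof. by split. Qed.

Lemma is_ideal_mul I J : is_ideal (ideal_mul I J).
Proof. exact: is_ideal_gen. Qed.

Lemma is_ideal_pow I n : is_ideal (ideal_pow I n).
Proof. by case: n => [|n]; [exact: is_idealT | exact: is_ideal_mul]. Qed.

Lemma is_ideal_colon I f : is_ideal I -> is_ideal (colon I f).
Proof.
case=> I0 ID IM; split; rewrite /colon /=; first by rewrite mul0r.
  by move=> x y Ix Iy; rewrite mulrDl; apply: ID.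
by move=> a x Ix; rewrite -mulrA; apply: IM.
Qed.

Lemma ideal_mul_mem I J a b : I a -> J b -> ideal_mul I J (a * b).
Proof. by move=> Ia Jb; apply: sub_ideal_gen; exists a, b. Qed.

Lemma ideal_mulC I J : ideal_mul I J = ideal_mul J I.
Proof.
by congr ideal_gen; apply/seteqP; split=> _ [a [b [Ia Jb ->]]];
  exists b, a; rewrite mulrC.
Qed.

(** One inclusion suffices: applied to L, J, I, it yields the other one by
  commutativity. *)
Lemma ideal_mulA I J L :
  ideal_mul I (ideal_mul J L) = ideal_mul (ideal_mul I J) L.
Proof.
have assoc_sub I' J' L' :
    ideal_mul (ideal_mul I' J') L' `<=` ideal_mul I' (ideal_mul J' L').
  apply: ideal_gen_sub; first exact: is_ideal_mul.
  move=> _ [x [c [IJx Lc ->]]].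
  (* For a fixed c in L', the elements x with x * c in I' (J' L') form an
     ideal, so only the generators a * b of I' J' have to be looked at. *)
  suff /(_ x IJx) :
    ideal_mul I' J' `<=` colon (ideal_mul I' (ideal_mul J' L')) c by [].
  apply: ideal_gen_sub; first exact/is_ideal_colon/is_ideal_mul.
  move=> _ [a [b [Ia Jb ->]]]; rewrite /colon /= -mulrA.
  by do 2?apply: ideal_mul_mem.
apply/seteqP; split; last exact: assoc_sub.
by rewrite ideal_mulC (ideal_mulC J) (ideal_mulC _ L) (ideal_mulC I).
Qed.

Lemma ideal_mulTl J : is_ideal J -> ideal_mul setT J = J.
Proof.
move=> idJ; have [_ _ JM] := idJ; apply/seteqP; split.
  by apply: ideal_gen_sub => // _ [a [b [_ Jb ->]]]; apply: JM.
by move=> x Jx; rewrite -[x]mul1r; apply: ideal_mul_mem.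
Qed.

Lemma ideal_powD I m n :
  ideal_pow I (m + n) = ideal_mul (ideal_pow I m) (ideal_pow I n).
Proof.
elim: m => [|m IHm]; first by rewrite ideal_mulTl //; apply: is_ideal_pow.
by rewrite addSn /= IHm ideal_mulA.
Qed.

Lemma ideal_powM I m n : ideal_pow (ideal_pow I m) n = ideal_pow I (n * m).
Proof. by elim: n => //= n IHn; rewrite mulSn ideal_powD IHn. Qed.

Lemma prime_exp_mem p x n : is_prime_ideal p -> p (x ^+ n) -> p x.
Proof.
case=> _ p1 pM; elim: n => [|n IHn]; first by rewrite expr0.
by rewrite exprS => /pM [].
Qed.

Lemma prime_prod_mem p (T : Type) (r : seq T) (F : T -> R) :
  is_prime_ideal p -> p (\prod_(i <- r) F i) -> exists i, p (F i).
Proof.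
case=> _ p1 pM; elim: r => [|i r IHr]; first by rewrite big_nil.
by rewrite big_cons => /pM [pi|/IHr]; first by exists i.
Qed.

Lemma ideal_pow_mem I x n : I x -> ideal_pow I n (x ^+ n).
Proof.
by move=> Ix; elim: n => // n IHn; rewrite exprS; apply: ideal_mul_mem.
Qed.

Lemma prime_pow_sub I p k :
  is_prime_ideal p -> ideal_pow I k `<=` p -> I `<=` p.
Proof.
move=> pp Ikp x Ix; apply: (@prime_exp_mem _ _ k pp).
exact/Ikp/ideal_pow_mem.
Qed.

Lemma pow_sub_prime I p k :
  (0 < k)%N -> is_prime_ideal p -> I `<=` p -> ideal_pow I k `<=` p.
Proof.
case: k => // k _ [idp _ _] Ip; have [_ _ pM] := idp.
apply: ideal_gen_sub => // _ [a [b [Ia _ ->]]].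
by rewrite mulrC; apply/pM/Ip.
Qed.

Lemma Ass_sub I p : is_ideal I -> Ass I p -> I `<=` p.
Proof. by case=> _ _ IM [_ [f ->]] x Ix; rewrite /colon /= mulrC; apply: IM. Qed.

Definition Ass_below_primes I :=
  forall q, is_prime_ideal q -> I `<=` q -> exists2 p, Ass I p & p `<=` q.

(** A prime p minimal in Ass(I) contains I^k, hence some q in Ass(I^k); that q
  contains I, hence some q' in Ass(I).  Minimality of p forces q' = q = p, so p
  is associated to I^k, and the same argument shows that it is minimal there. *)
Lemma minAss_pow_sub I k : (0 < k)%N -> is_ideal I ->
  Ass_below_primes I -> Ass_below_primes (ideal_pow I k) ->
  minAss I `<=` minAss (ideal_pow I k).
Proof.
move=> k_gt0 idI belowI belowIk p [Ip minp].
have idIk := is_ideal_pow I k.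
have min_pow q : Ass (ideal_pow I k) q -> q `<=` p -> q = p.
  move=> Ikq qp; have pq : is_prime_ideal q by case: Ikq.
  have Iq : I `<=` q by apply: (@prime_pow_sub _ _ k) => //; apply: Ass_sub.
  have [q' Iq' q'q] := belowI q pq Iq.
  have q'p : q' = p by apply: minp => // x /q'q /qp.
  by apply/seteqP; split=> //; rewrite -q'p.
split=> //; have pp : is_prime_ideal p by case: Ip.
have [q Ikq qp] := belowIk p pp (pow_sub_prime k_gt0 pp (Ass_sub idI Ip)).
by rewrite -(min_pow q).
Qed.

End IdealTheory.

(** * Symbolic powers against ordinary powers *)

Section SymbolicPower.

Import GRing.Theory.
Local Open Scope ring_scope.
Local Open Scope classical_set_scope.

Variable R : idomainType.

Lemma pow_sub_symbolic (I : set R) n : ideal_pow I n `<=` symbolic_power I n.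
Proof.
move=> f Inf p [[[_ p1 _] _] _]; exists 1%N, (fun=> 1), (fun=> tofrac f).
split; [|by exists f|by rewrite big_ord1 mul1r].
by move=> _; exists 1, 1; split; rewrite // divr1 ?tofrac1.
Qed.

Lemma symbolic_pow_sub (I : set R) k n : minAss I `<=` minAss (ideal_pow I k) ->
  symbolic_power (ideal_pow I k) n `<=` symbolic_power I (n * k).
Proof. by move=> sub f fS p /sub /fS; rewrite /= ideal_powM. Qed.

End SymbolicPower.

(** * Associated primes of monomial ideals *)

Section MonomialIdeals.

Import GRing.Theory.
Local Open Scope ring_scope.
Local Open Scope classical_set_scope.

Variables (K : fieldType) (s : nat).
Implicit Types (I J q : set {mpoly K[s]}) (A : {set 'I_s}) (m w : 'X_{1..s}).

(** For an ideal this is equivalent to being generated by monomials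
  ([monomial_idealP]), and unlike the choice of a generating set it is easy to
  carry through products and colons. *)
Definition monomial_closed I :=
  forall f w, I f -> w \in msupp f -> I 'X_[w].

Lemma mem_ideal_of_msupp I f :
  is_ideal I -> (forall w, w \in msupp f -> I 'X_[w]) -> I f.
Proof.
move=> idI If; have [_ _ IM] := idI; rewrite [f]mpolyE big_seq.
by apply: ideal_sum => // w /If Iw; rewrite -mul_mpolyC; apply: IM.
Qed.

Lemma monomial_idealP I :
  is_monomial_ideal I <-> is_ideal I /\ monomial_closed I.
Proof.
split=> [[A ->]|[idI monI]]; last first.
  exists [set w | I 'X_[w]]; apply/seteqP; split; last first.
    by apply: ideal_gen_sub => // _ [w Iw <-].
  move=> f If; apply: mem_ideal_of_msupp; first exact: is_ideal_gen.
  by move=> w wf; apply: sub_ideal_gen; exists w => //; apply: monI wf.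
split; first exact: is_ideal_gen.
move=> _ w [n [c [a [_ Aa ->]]]] /msupp_sum_le /flattenP [_ /mapP [i _ ->]].
case: (Aa i) => m Am <- /msuppM_le /allpairsP [[u v] [/= _]].
rewrite msuppX inE => /eqP -> ->; rewrite mpolyXD.
have [_ _ gM] := is_ideal_gen [set ('X_[m] : {mpoly K[s]}) | m in A].
by apply/gM/sub_ideal_gen; exists m.
Qed.

Lemma monomial_mul I J : monomial_closed I -> monomial_closed J ->
  monomial_closed (ideal_mul I J).
Proof.
move=> monI monJ _ w [n [c [x [_ IJx ->]]]].
move=> /msupp_sum_le /flattenP [_ /mapP [i _ ->]].
case: (IJx i) => a [b [Ia Jb ->]].
move=> /msuppM_le /allpairsP [[u v] [/= _]].
move=> /msuppM_le /allpairsP [[u' v'] [/= u'a v'b -> ->]].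
have [_ _ IJM] := is_ideal_mul I J.
rewrite !mpolyXD; apply: IJM; apply: ideal_mul_mem; first exact: monI u'a.
exact: monJ v'b.
Qed.

Lemma monomial_pow I k :
  is_monomial_ideal I -> is_monomial_ideal (ideal_pow I k).
Proof.
move=> /monomial_idealP [_ monI]; apply/monomial_idealP.
split; first exact: is_ideal_pow.
by elim: k => //= k IHk; apply: monomial_mul.
Qed.

Definition meets A m := [exists i in A, m i != 0%N].

(** The prime generated by the variables of A is encoded as the kernel of the
  substitution t_i := 0 for i in A.  Its target is a domain, so primality is
  immediate, and [face_idealP] recovers the description by monomials. *)
Definition zero_out A (i : 'I_s) : {mpoly K[s]} := if i \in A then 0 else 'X_i.

Definition kill A : {mpoly K[s]} -> {mpoly K[s]} :=
  mmap (@mpolyC s K) (zero_out A).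

Definition face_ideal A : set {mpoly K[s]} := [set f | kill A f = 0].

Lemma kill_monomial A m : mmap1 (zero_out A) m = if meets A m then 0 else 'X_[m].
Proof.
case: ifPn => [/exists_inP [i iA mi]|/exists_inPn mA].
  rewrite /mmap1 (bigD1 i) //= {1}/zero_out iA expr0n.
  by rewrite (negbTE mi) mul0r.
rewrite mpolyXE_id; apply: eq_bigr => i _; rewrite /zero_out.
case: ifP => // /mA; rewrite negbK => /eqP ->.
by rewrite !expr0.
Qed.

Lemma face_idealP A f :
  face_ideal A f <-> forall w, w \in msupp f -> meets A w.
Proof.
have killE : kill A f = \sum_(m <- msupp f | ~~ meets A m) f@_m *: 'X_[m].
  rewrite /kill /mmap [RHS]big_mkcond; apply: eq_bigr => m _.
  by rewrite kill_monomial mul_mpolyC; case: meets; rewrite ?scaler0.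
rewrite /face_ideal /= killE; split=> [f0 w wf|Af]; last first.
  by rewrite big_seq_cond big1 // => w /andP [/Af ->].
apply: contraTT wf => wA; rewrite mcoeff_msupp negbK.
rewrite [f]mpolyE (bigID (meets A)) /= f0 addr0 raddf_sum /= big1 // => m mA.
rewrite mcoeffZ mcoeffX; case: eqP => [mw|_]; last by rewrite mulr0.
by rewrite mw (negbTE wA) in mA.
Qed.

Lemma face_ideal_prime A : is_prime_ideal (face_ideal A).
Proof.
rewrite /face_ideal /kill; split=> /=.
- split=> [|x y /= x0 y0|a x /= x0] /=; first exact: rmorph0.
    by rewrite rmorphD /= x0 y0 addr0.
  by rewrite rmorphM /= x0 mulr0.
- by rewrite rmorph1 => /eqP; rewrite oner_eq0.
- by move=> x y /eqP; rewrite rmorphM mulf_eq0 => /orP [] /eqP; [left|right].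
Qed.

(** For a monomial ideal J this says that J is contained in [face_ideal A]; only
  monomials are mentioned so that minimality of A produces monomials of J. *)
Definition covers A J := forall w, J 'X_[w] -> meets A w.

Lemma prime_meets q w : is_prime_ideal q -> q 'X_[w] ->
  exists2 i, q 'X_i & w i != 0%N.
Proof.
move=> pq; rewrite mpolyXE_id => /(prime_prod_mem pq) [i qi].
exists i; first exact: prime_exp_mem qi.
apply: contraPneq qi => ->; rewrite expr0; by case: pq.
Qed.

Lemma ideal_monomial_le J m w :
  is_ideal J -> J 'X_[m] -> (m <= w)%MM -> J 'X_[w].
Proof. by case=> _ _ JM Jm mw; rewrite -(submK mw) mpolyXD; apply: JM. Qed.

(** Call m good if no multiple of t^m by a monomial in the variables outside A
  lies in J, that is, if t^m stays outside J after inverting those variables.  By minimality of A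
  the A-degree of good monomials is bounded, and a good monomial of largest
  A-degree becomes, after multiplication by enough variables outside A, a
  monomial t^M with (J : t^M) = P_A. *)
Lemma face_ideal_Ass J A : is_ideal J -> monomial_closed J ->
  minset (fun B => `[< covers B J >]) A -> Ass J (face_ideal A).
Proof.
move=> idJ monJ /minsetP [/asboolP covA minA]; split; first exact: face_ideal_prime.
pose good m := forall w, ~~ meets A w -> ~ J 'X_[m + w].
have good0 : good 0%MM by move=> w /negP wA; rewrite add0m => /covA.
have bound i : exists b, i \in A -> forall m, good m -> (m i < b)%N.
  have [iA|] := boolP (i \in A); last by exists 0%N.
  (* Minimality of A at i yields a monomial t^v of J whose only variable in A
     is t_i; the exponent of t_i in a good monomial stays below v i, since
     otherwise multiplying by the part of t^v outside A would land in J. *)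
  have : ~ covers (A :\ i) J.
    move=> /asboolP cov; have /setP/(_ i) := minA _ cov (subsetDl _ _).
    by rewrite !inE eqxx iA.
  move=> /existsNP [v /not_implyP [Jv /negP /exists_inPn vA]].
  exists (v i) => _ m gm; rewrite ltnNge; apply/negP => le_vm.
  pose w := [multinom (if j \in A then 0%N else v j) | j < s].
  apply: (gm w).
    by apply/exists_inPn => j jA; rewrite mnmE jA.
  apply: (@ideal_monomial_le J v) => //; apply/mnm_lepP => j.
  rewrite mnmDE mnmE; have [jA|_] := boolP (j \in A); last exact: leq_addl.
  rewrite addn0; have [-> //|ji] := eqVneq j i.
  by have := vA j; rewrite !inE ji jA negbK => /(_ isT) /eqP ->.
have {bound} [b bP] := choice bound.
pose degA m := (\sum_(i in A) m i)%N.
pose attained d := `[< exists2 m, good m & degA m = d >].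
have ex_att : exists d, attained d.
  by exists (degA 0%MM); apply/asboolP; exists 0%MM.
have bound_att d : attained d -> (d <= \sum_(i in A) b i)%N.
  move=> /asboolP [m gm <-]; apply: leq_sum => i iA.
  by apply/ltnW/bP.
have [_ /asboolP [m gm <-] maxm] := ex_maxnP ex_att bound_att.
(* By maximality m + U_(i) is not good, and v is the witness of that. *)
have step i : exists v, i \in A -> ~~ meets A v /\ J 'X_[m + U_(i) + v].
  have [iA|] := boolP (i \in A); last by exists 0%MM.
  have : ~ good (m + U_(i))%MM.
    move=> gmi; have : attained (degA (m + U_(i))%MM).
      by apply/asboolP; exists (m + U_(i))%MM.
    move=> /maxm; rewrite leqNgt => /negP; apply.
    rewrite /degA !(bigD1 i iA) /= -addSn; apply: leq_add.
      by rewrite mnmDE mnm1E eqxx addn1.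
    by apply: leq_sum => j _; rewrite mnmDE leq_addr.
  by move=> /existsNP [v /not_implyP [vA /contrapT Jv]]; exists v.
have {step} [v vP] := choice step.
(* The single monomial t^M absorbs the witnesses v i for all i in A at once. *)
pose M := (m + \sum_(i in A) v i)%MM.
have vA : ~~ meets A (\sum_(i in A) v i)%MM.
  apply/exists_inPn => j jA; rewrite negbK mnm_sumE big1 // => i iA.
  by have [/exists_inPn/(_ j jA)] := vP i iA; rewrite negbK => /eqP.
exists 'X_[M]; apply/seteqP; split=> f.
  move=> /face_idealP fA; apply: mem_ideal_of_msupp; first exact: is_ideal_colon.
  move=> w /fA /exists_inP [i iA wi]; rewrite /colon /= -mpolyXD.
  have [_ Jv] := vP i iA; apply: ideal_monomial_le Jv _ => //.
  apply/mnm_lepP => j; rewrite !mnmDE mnm_sumE (bigD1 i) //= mnm1E.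
  by case: (eqVneq i j) wi => [<-|_] wi; lia.
rewrite /colon /= => Jf; apply/face_idealP => w wf.
have Jw : J 'X_[M + w].
  by apply: monJ Jf _; rewrite mcoeff_msupp mcoeffMX -mcoeff_msupp.
apply: contraPT Jw => wA; rewrite -addmA; apply: gm.
apply/exists_inPn => j jA; rewrite negbK mnmDE.
have /exists_inPn/(_ j jA) := vA; rewrite negbK => /eqP ->.
by have /exists_inPn/(_ j jA) := wA; rewrite negbK.
Qed.

(** The variables contained in q cover J, and the face ideal of a minimal cover
  among them is an associated prime below q. *)
Lemma monomial_Ass_below J : is_monomial_ideal J -> Ass_below_primes J.
Proof.
move=> /monomial_idealP [idJ monJ] q pq Jq.
have cov : covers [set i | `[< q 'X_i >]]%SET J.
  move=> w /Jq /(prime_meets pq) [i qi wi].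
  by apply/exists_inP; exists i => //; rewrite inE; apply/asboolP.
have [A minA /fintype.subsetP Aq] :=
  minset_exists (P := fun B => `[< covers B J >]) (introT (asboolP _) cov).
exists (face_ideal A); first exact: face_ideal_Ass.
have [idq _ _] := pq.
move=> f /face_idealP fA; apply: mem_ideal_of_msupp => // w /fA.
move=> /exists_inP [i /Aq]; rewrite inE => /asboolP qi wi.
apply: ideal_monomial_le idq qi _; apply/mnm_lepP => j.
by rewrite mnm1E; case: eqP => // <-; rewrite lt0n.
Qed.

End MonomialIdeals.

Theorem proposition5p9 (K : fieldType) (s : nat) (I : set {mpoly K[s]})
    (k : nat) (hI : is_simis_ideal I) (hk : (1 <= k)%N) :
  is_simis_ideal (ideal_pow I k).
Proof.
have [monI simisI] := hI; have monIk := monomial_pow k monI.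
split=> // n n_gt0; apply/seteqP; split; last exact: pow_sub_symbolic.
rewrite ideal_powM -(simisI (n * k)%N) ?muln_gt0 ?n_gt0 //; apply: symbolic_pow_sub.
have [idI _] := (monomial_idealP I).1 monI.
by apply: minAss_pow_sub => //; apply: monomial_Ass_below.
Qed.
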